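(* Let $\theta$ be an irrational number and $\mathbb{T}_\theta$ the irrational torus of slope $\theta$. The natural map $\mathbb{T}_\theta\to DT\mathbb{T}_\theta$ is not a weak equivalence. Moreover, $\mathbb{T}_\theta$ does not have the smooth homotopy type of a topological space; that is, there is no topological space $Y$ such that $\mathbb{T}_\theta$ is homotopy equivalent to $DY$ in $\mathbf{Diff}$.
   Context: $\mathbf{Diff}$ is the category of diffeological spaces and smooth maps. The irrational torus $\mathbb{T}_\theta$ is the quotient of the 2-torus $\mathbb{T}^2=\mathbf{R}^2/\mathbf{Z}^2$ by the one-parameter subgroup $\{[t,\theta t]\mid t\in\mathbf{R}\}$, equipped with the quotient diffeology (the finest diffeology making the projection $\mathbb{T}^2\to\mathbb{T}_\theta$ smooth). The functor $T\colon\mathbf{Diff}\to\mathbf{Top}$ takes a diffeological space to its underlying set with the finest topology making all plots continuous; $D\colon\mathbf{Top}\to\mathbf{Diff}$ takes a topological space to its underlying set with the diffeology of all continuous parameterizations. $T$ is left adjoint to $D$, and the natural map $X\to DTX$ is the unit (identity on underlying sets). $I=[0,1]$ and $I^n$ have the subspace diffeology. Two smooth maps $f_0,f_1\colon X\to Y$ are homotopic if there is a smooth map $F\colon X\times I\to Y$ with $F(x,0)=f_0(x)$, $F(x,1)=f_1(x)$; homotopy equivalences are smooth maps having a smooth inverse up to homotopy. $\pi_n(X,x_0)$ is the set of homotopy classes of smooth maps $(I^n,\partial I^n)\to(X,x_0)$ (through homotopies of maps of pairs). A smooth map $f\colon X\to Y$ is a weak equivalence if $f_*\colon\pi_n(X,x)\to\pi_n(Y,f(x))$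 is bijective for every $x\in X$ and $n\ge0$. *)

(* Defs.v *)
From HB Require Import structures.
From mathcomp Require Import all_boot all_order all_algebra.
From mathcomp Require Import ring lra.
From mathcomp Require Import all_classical all_reals all_analysis.
Import Order.TTheory GRing.Theory Num.Theory.
Import numFieldNormedType.Exports.

Set Implicit Arguments.
Unset Strict Implicit.
Unset Printing Implicit Defensive.

Local Open Scope classical_set_scope.
Local Open Scope ring_scope.

Section Smoothness.
Variable R : realType.
Implicit Types n m k : nat.

(* f is of class C^k on the open set U: C^0 means continuous, and C^(k+1) means
   differentiable with all first-order partial derivatives of class C^k. *)
Fixpoint Ck n k (U : set 'rV[R]_n) (f : 'rV[R]_n -> R) : Prop :=
  match k with
  | 0 => {within U, continuous f}
  | k'.+1 => (forall x, U x -> differentiable f x) /\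
      forall i : 'I_n, Ck k' U (fun x => 'D_(delta_mx 0 i) f x)
  end.

Definition smooth_fct n (U : set 'rV[R]_n) (f : 'rV[R]_n -> R) : Prop :=
  forall k, Ck k U f.

Definition smooth_param n m (U : set 'rV[R]_n) (f : 'rV[R]_n -> 'rV[R]_m) :=
  forall j : 'I_m, smooth_fct U (fun x => f x 0 j).

Lemma near_eq_differentiable (V W : normedModType R) (f g : V -> W) x :
  (\near x, f x = g x) -> differentiable f x -> differentiable g x.
Proof.
move=> fg df.
have fgx : f x = g x by exact: nbhs_singleton fg.
have E : g \o shift x = cst (g x) + 'd f x +o_ 0 id.
  apply/eqaddoP => e e0.
  have /eqaddoP /(_ e e0) := diff_locally df.
  have /= : \forall h \near 0, f (h + x) = g (h + x).
    have := fg; rewrite (near_shift 0) /= => H.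
    by apply: filterS H => y /=; rewrite subr0.
  move=> A B; near=> h.
  have Ah : f (h + x) = g (h + x) by near: h.
  have := near B h; rewrite /= => Bh.
  rewrite /= !fctE /= -Ah -fgx.
  have : `|(f \o shift x - (cst (f x) + 'd f x)) h| <= e * `|h| by near: h.
  by rewrite /= !fctE.
apply/diff_locallyP.
have -> : 'd g x = 'd f x :> (V -> W).
  by apply: diff_unique => //; exact: diff_continuous.
by split => //; exact: diff_continuous.
Unshelve. all: by end_near. Qed.

Lemma Ck_within n k (U V : set 'rV[R]_n) f g : open V -> V `<=` U ->
  {in V, f =1 g} -> Ck k U f -> Ck k V g.
Proof.
move=> oV VU; elim: k f g => [|k IH] f g fg /=.
  move=> cf.
  have cfV : {within V, continuous f} by exact: continuous_subspaceW VU cf.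
  exact: subspace_eq_continuous fg cfV.
have near_fg x : V x -> \near x, f x = g x.
  move=> Vx; move: (open_nbhs_nbhs (conj oV Vx)).
  by apply: filterS => y Vy; apply: fg; rewrite inE.
move=> [df Df]; split=> [x Vx|i].
  by apply: near_eq_differentiable (near_fg _ Vx) _; apply: df; exact: VU.
apply: IH (Df i) => x; rewrite inE => Vx.
by apply: near_eq_derive; exact: near_fg.
Qed.

Lemma Ck_eq n k (U : set 'rV[R]_n) f g : open U ->
  {in U, f =1 g} -> Ck k U f -> Ck k U g.
Proof. by move=> oU; exact: Ck_within. Qed.

Lemma Ck_local n k (U : set 'rV[R]_n) f : open U ->
  (forall x, U x -> exists V, [/\ open V, V x & Ck k V f]) -> Ck k U f.
Proof.
move=> oU; elim: k f => [|k IH] f H /=.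
  rewrite continuous_open_subspace// => x; rewrite inE => Ux.
  have [V [oV Vx]] := H x Ux.
  by rewrite /= continuous_open_subspace// => /(_ x); apply; rewrite inE.
split=> [x /H[V [oV Vx [+ _]]]|i]; first by apply.
by apply: IH => x /H[V [oV Vx [_ /(_ i)]]] ?; exists V.
Qed.

Lemma Ck_cst n k (U : set 'rV[R]_n) (c : R) : Ck k U (cst c).
Proof.
elim: k c => [|k IH] c /=.
  by apply: continuous_subspaceT => x; exact: cst_continuous.
split=> [x _|i]; first exact: differentiable_cst.
rewrite (_ : (fun x => _) = cst 0) //; apply/funext => x.
by rewrite derive_cst.
Qed.

Lemma CkS n k (U : set 'rV[R]_n) f : open U -> Ck k.+1 U f -> Ck k U f.
Proof.
move=> oU; elim: k f => [|k IH] f [df Df].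
  rewrite /= continuous_open_subspace// => x; rewrite inE => Ux.
  exact/differentiable_continuous/df.
by split=> // i; apply: IH; exact: Df.
Qed.

Lemma CkD n k (U : set 'rV[R]_n) f g : open U ->
  Ck k U f -> Ck k U g -> Ck k U (fun x => f x + g x).
Proof.
move=> oU; elim: k f g => [|k IH] f g /=.
  rewrite !continuous_open_subspace// => cf cg x Ux.
  by apply: continuousD; [exact: cf|exact: cg].
move=> [df Df] [dg Dg]; split=> [x Ux|i].
  by apply: differentiableD; [exact: df|exact: dg].
apply: Ck_eq (IH _ _ (Df i) (Dg i)) => // x; rewrite inE => Ux.
by rewrite deriveD//; apply: diff_derivable; [exact: df|exact: dg].
Qed.

Lemma CkM n k (U : set 'rV[R]_n) f g : open U ->
  Ck k U f -> Ck k U g -> Ck k U (fun x => f x * g x).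
Proof.
move=> oU; elim: k f g => [|k IH] f g.
  rewrite /= !continuous_open_subspace// => cf cg x Ux.
  by apply: continuousM; [exact: cf|exact: cg].
move=> Cf Cg; have [df Df] := Cf; have [dg Dg] := Cg.
split=> [x Ux|i].
  by apply: differentiableM; [exact: df|exact: dg].
have := CkD oU (IH _ _ (CkS oU Cf) (Dg i)) (IH _ _ (CkS oU Cg) (Df i)).
apply: Ck_eq => // x; rewrite inE => Ux.
by rewrite deriveM//; apply: diff_derivable; [exact: df|exact: dg].
Qed.

Lemma Ck_sum n k (U : set 'rV[R]_n) m (F : 'I_m -> 'rV[R]_n -> R) : open U ->
  (forall i, Ck k U (F i)) -> Ck k U (fun x => \sum_(i < m) F i x).
Proof.
move=> oU; elim: m F => [|m IH] F CF.
  by apply: Ck_eq (Ck_cst k U 0) => // x _; rewrite big_ord0.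
have := CkD oU (IH (fun i => F (widen_ord (leqnSn m) i)) (fun i => CF _))
  (CF ord_max).
by apply: Ck_eq => // x _; rewrite big_ord_recr.
Qed.

Lemma Ck_coord n k (U : set 'rV[R]_n) (j : 'I_n) : Ck k U (fun x => x 0 j).
Proof.
case: k => [|k] /=.
  by apply: continuous_subspaceT => x; exact: coord_continuous.
split=> [x _|i]; first exact: differentiable_coord.
rewrite (_ : (fun x => _) = cst ((j == i)%:R : R)); first exact: Ck_cst.
apply/funext => x; rewrite deriveE; last exact: differentiable_coord.
have L : linear (fun N : 'rV[R]_n => N 0 j : R).
  by move=> a u v; rewrite !mxE.
pose LL := GRing.isLinear.Build _ _ _ _ (fun N : 'rV[R]_n => N 0 j : R) L.
pose l : {linear 'rV[R]_n -> R} := HB.pack (fun N : 'rV[R]_n => N 0 j : R) LL.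
rewrite (_ : (fun N : 'rV[R]_n => N 0 j) = l) //.
rewrite diff_lin; first by rewrite /= mxE eqxx.
exact: coord_continuous.
Qed.

Lemma differentiable_coords n m (f : 'rV[R]_n -> 'rV[R]_m) x :
  (forall j, differentiable (fun y => f y 0 j) x) -> differentiable f x.
Proof.
move=> H.
rewrite (_ : f = \sum_(j < m) (fun y => f y 0 j *: (delta_mx 0 j : 'rV[R]_m))).
  by apply: differentiable_sum => j; apply: differentiableZl; exact: H.
apply/funext => y; rewrite fct_sumE; apply/rowP => j.
by rewrite [in LHS](row_sum_delta (f y)).
Qed.

Lemma derive_comp_coords n m (f : 'rV[R]_n -> 'rV[R]_m) (g : 'rV[R]_m -> R) x v :
  (forall j, differentiable (fun y => f y 0 j) x) -> differentiable g (f x) ->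
  'D_v (g \o f) x =
  \sum_(j < m) 'D_v (fun y => f y 0 j) x * 'D_(delta_mx 0 j) g (f x).
Proof.
move=> df dg; have dF := differentiable_coords df.
rewrite deriveE; last exact: differentiable_comp.
rewrite diff_comp //= [in LHS](row_sum_delta ('d f x v)) linear_sum.
apply: eq_bigr => j _; rewrite linearZ /=.
rewrite -[in LHS](deriveE _ dg); congr (_ * _).
rewrite deriveE //.
have := @diff_comp _ _ _ _ f (fun N : 'rV[R]_m => N 0 j : R) x dF.
move=> /(_ (differentiable_coord _ _ _)) /(congr1 (fun h => h v)) /= ->.
have L : linear (fun N : 'rV[R]_m => N 0 j : R).
  by move=> a u w; rewrite !mxE.
pose LL := GRing.isLinear.Build _ _ _ _ (fun N : 'rV[R]_m => N 0 j : R) L.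
pose l : {linear 'rV[R]_m -> R} := HB.pack (fun N : 'rV[R]_m => N 0 j : R) LL.
rewrite (_ : (fun N : 'rV[R]_m => N 0 j) = l) //.
by rewrite diff_lin //; exact: coord_continuous.
Qed.

Lemma continuous_coords n m (f : 'rV[R]_n -> 'rV[R]_m) x :
  (forall j, {for x, continuous (fun y => f y 0 j)}) -> {for x, continuous f}.
Proof.
move=> cf.
have FF : Filter (f y @[y --> x]) by apply: (fmap_filter _ (nbhs_filter x)).
apply/(@cvg_mx_entourageP R 1 m _ FF) => A entA.
have H : \forall y \near x, forall j, (f x 0 j, f y 0 j) \in A.
  apply: (@filter_forall _ _ _ _ (nbhs_filter x)) => j.
  have /cvg_app_entourageP /(_ A entA) := cf j.
  by apply: filterS => y; rewrite inE.
by apply: filterS H => y Hy i j; rewrite ord1; exact: Hy.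
Qed.

Lemma Ck_comp n m k (U : set 'rV[R]_n) (V : set 'rV[R]_m)
    (f : 'rV[R]_n -> 'rV[R]_m) (g : 'rV[R]_m -> R) :
  open U -> open V -> (forall x, U x -> V (f x)) ->
  (forall j, Ck k U (fun x => f x 0 j)) -> Ck k V g -> Ck k U (g \o f).
Proof.
move=> oU oV UV; elim: k g => [|k IH] g Cf.
  rewrite /= !continuous_open_subspace// => cg x; rewrite inE => Ux.
  apply: continuous_comp; last by apply: cg; rewrite inE; exact: UV.
  apply: continuous_coords => j.
  have := Cf j; rewrite /= continuous_open_subspace// => /(_ x).
  by rewrite inE; exact.
move=> [dg Dg].
have df j x : U x -> differentiable (fun y => f y 0 j) x.
  by move=> Ux; have [+ _] := Cf j; apply.
split=> [x Ux|i].
  apply: differentiable_comp; last exact/dg/UV.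
  by apply: differentiable_coords => j; exact: df.
have C j : Ck k U (fun x => f x 0 j) by apply: CkS.
have := @Ck_sum n k U m
 (fun j x => 'D_(delta_mx 0 i) (fun y => f y 0 j) x * 'D_(delta_mx 0 j) g (f x)) oU.
move=> /(_ (fun j => CkM oU (proj2 (Cf j) i) (IH _ C (Dg j)))).
apply: Ck_eq => // x; rewrite inE => Ux.
rewrite derive_comp_coords//; first by move=> j; exact: df.
exact/dg/UV.
Qed.

Lemma smooth_param_continuous n m (U : set 'rV[R]_n)
    (f : 'rV[R]_n -> 'rV[R]_m) :
  open U -> smooth_param U f -> {in U, continuous f}.
Proof.
move=> oU sf x Ux; apply: continuous_coords => j.
by have := sf j 0; rewrite /= continuous_open_subspace// => /(_ x); exact.
Qed.

Lemma smooth_fct_comp n m (U : set 'rV[R]_n) (V : set 'rV[R]_m)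
    (f : 'rV[R]_n -> 'rV[R]_m) (g : 'rV[R]_m -> R) :
  open U -> open V -> (forall x, U x -> V (f x)) ->
  smooth_param U f -> smooth_fct V g -> smooth_fct U (g \o f).
Proof.
by move=> oU oV UV sf sg k; apply: (Ck_comp oU oV UV) => // j; exact: sf.
Qed.

Lemma smooth_fct_local n (U : set 'rV[R]_n) f : open U ->
  (forall x, U x -> exists V g,
    [/\ open V, V x, V `<=` U, smooth_fct V g & {in V, g =1 f}]) ->
  smooth_fct U f.
Proof.
move=> oU H k; apply: Ck_local => // x /H[V [g [oV Vx VU sg gf]]].
by exists V; split=> //; exact: Ck_eq (sg k).
Qed.

End Smoothness.

Section FlatFunction.
Variable R : realType.

(* The functions t^-m * exp(-1/t), extended by 0 to t <= 0; they are used only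
   to build the smooth step function that concatenates smooth homotopies. *)
Definition flat (m : nat) (t : R) : R :=
  if t <= 0 then 0 else t^-1 ^+ m * expR (- t^-1).

Lemma flat_le0 m t : t <= 0 -> flat m t = 0.
Proof. by rewrite /flat => ->. Qed.

Lemma flatE m t : 0 < t -> flat m t = t^-1 ^+ m * expR (- t^-1).
Proof. by rewrite /flat leNgt => ->. Qed.

Lemma flat_gt0 m t : 0 < t -> 0 < flat m t.
Proof.
by move=> t0; rewrite flatE// mulr_gt0 ?expR_gt0// exprn_gt0// invr_gt0.
Qed.

Lemma flat_ge0 m t : 0 <= flat m t.
Proof. by have [/(flat_le0 m)->//|/(flat_gt0 m)/ltW] := leP t 0. Qed.

Lemma flat0_homo : {homo flat 0 : s t / s <= t}.
Proof.
move=> s t st; have [/(flat_le0 0)->|s0] := leP s 0; first exact: flat_ge0.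
have t0 := lt_le_trans s0 st.
rewrite !flatE// !expr0 !mul1r ler_expR lerN2.
by rewrite lef_pV2// posrE.
Qed.

Lemma flat_le m t : 0 <= t -> flat m t <= m.+1%:R ^+ m.+1 * t.
Proof.
rewrite le_eqVlt => /predU1P[<-|t0]; first by rewrite flat_le0// mulr0.
rewrite flatE// expRN ler_pdivrMr ?expR_gt0//.
have E : (t^-1 / m.+1%:R) ^+ m.+1 <= expR t^-1.
  have -> : expR t^-1 = expR (t^-1 / m.+1%:R) ^+ m.+1.
    by rewrite -expRM_natl mulrC divfK// pnatr_eq0.
  apply: lerXn2r; rewrite ?nnegrE ?expR_ge0 ?divr_ge0 ?invr_ge0 ?ltW//.
  by apply: lt_le_trans (expR_ge1Dx _); rewrite ltrDr.
rewrite -mulrA -ler_pdivrMl ?exprn_gt0// -ler_pdivrMl//.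
apply: le_trans E; rewrite expr_div_n le_eqVlt; apply/orP; left; apply/eqP.
by rewrite [in RHS]exprS; ring.
Qed.

Lemma flat_is_derive m (t : R) :
  is_derive t 1 (flat m) (flat m.+2 t - m%:R * flat m.+1 t).
Proof.
have [t0|t0|->] := ltgtP t 0.
- apply: (@near_eq_is_derive _ _ _ (cst 0)).
    near=> s; rewrite /= flat_le0//.
    by near: s; exact: lt_le_nbhsl.
  by rewrite !flat_le0 ?ltW// mulr0 subr0; exact: is_derive_cst.
- suff F : is_derive t 1 (fun s : R => s^-1 ^+ m * expR (- s^-1))
      (flat m.+2 t - m%:R * flat m.+1 t).
    apply: near_eq_is_derive F; near=> s; rewrite flatE//.
    by near: s; exact: lt_nbhsr.
  have tn0 : t != 0 by rewrite gt_eqF.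
  rewrite !flatE//.
  have dV : is_derive t 1 (fun s : R => s^-1) (- t ^- 2 *: (1 : R)).
    exact: is_deriveV.
  have dX := is_deriveX m dV.
  have dE : is_derive t 1 (fun s : R => expR (- s^-1))
      (expR (- t^-1) * (- (- t ^- 2 *: 1))).
    exact: (@is_derive1_comp _ expR (fun s : R => - s^-1)).
  have dM := is_deriveM dX dE.
  have -> : (fun s : R => s^-1 ^+ m * expR (- s^-1)) =
      (fun s : R => s^-1) ^+ m * (fun s : R => expR (- s^-1)).
    by apply/funext => s; rewrite [RHS]/GRing.mul /= exprfctE.
  apply: is_derive_eq.
  rewrite /GRing.scale /= !exprfctE.
  clear dM dX; case: m => [|m] /=.
    by rewrite !expr0 !mul0r !mulr0 addr0 subr0 !mulr1 !mul1r opprK mulrC exprVn.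
  rewrite !exprVn !exprS; move: (expR _) => E; field.
  by rewrite tn0 expf_neq0.
have H : h^-1 *: ((flat m \o shift 0) (h *: 1) - flat m 0) @[h --> 0^'] --> (0 : R).
  apply/cvgrPdist_le => e e0.
  have C0 : 0 < (m.+2%:R ^+ m.+2 : R) by rewrite exprn_gt0.
  near=> h.
  rewrite /= addr0 (@flat_le0 m 0)// subr0 sub0r normrN /GRing.scale /= mulr1.
  have [h0|h0] := leP h 0; first by rewrite flat_le0// mulr0 normr0 ltW.
  have -> : h^-1 * flat m h = flat m.+1 h.
    by rewrite !flatE// exprS mulrA.
  rewrite ger0_norm ?flat_ge0//.
  apply: le_trans (flat_le _ (ltW h0)) _.
  rewrite -ler_pdivlMl// mulrC.
  have : `|h| < e / m.+2%:R ^+ m.+2.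
    by near: h; apply: dnbhs0_lt; rewrite divr_gt0.
  by rewrite gtr0_norm// => /ltW.
rewrite !flat_le0// mulr0 subr0; apply: DeriveDef.
  by apply/cvg_ex; exists 0.
exact: cvg_lim H.
Unshelve. all: by end_near. Qed.

Lemma Ck_comp1 n k (U : set 'rV[R]_n) (h h' : R -> R) q : open U ->
  (forall t : R, is_derive t 1 h (h' t)) ->
  Ck k U (h' \o q) -> Ck k.+1 U q -> Ck k.+1 U (h \o q).
Proof.
move=> oU dh Ch [dq Dq].
have diffh t : differentiable h t by apply/derivable1_diffP; have [] := dh t.
split=> [x Ux|i].
  by apply: differentiable_comp => //; exact: dq.
have := CkM oU Ch (Dq i); apply: Ck_eq => // x; rewrite inE => Ux.
have dqx := dq x Ux.
have [dhx Eh] := dh (q x).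
rewrite [RHS]deriveE; last exact: differentiable_comp.
rewrite diff_comp//=; apply/esym.
apply: etrans (congr1 (fun F => F ('d q x (delta_mx 0 i))) (deriv1E dhx)) _.
by rewrite derive1E Eh -deriveE// /GRing.scale /= mulrC.
Qed.

Lemma Ck_flat n k m (U : set 'rV[R]_n) q : open U ->
  Ck k U q -> Ck k U (flat m \o q).
Proof.
move=> oU; elim: k m => [|k IH] m Cq.
  move: Cq; rewrite /= !continuous_open_subspace// => cq x Ux.
  apply: continuous_comp; first exact: cq.
  apply: differentiable_continuous; apply/derivable1_diffP.
  by have [] := flat_is_derive m (q x).
apply: (Ck_comp1 oU (flat_is_derive m) _ Cq).
have Cq' := CkS oU Cq.
have := CkD oU (IH m.+2 Cq') (CkM oU (Ck_cst k U (- m%:R)) (IH m.+1 Cq')).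
by apply: Ck_eq => // x _ /=; rewrite mulNr.
Qed.

Definition step (t : R) : R :=
  flat 0 (flat 0 1 - flat 0 (1 - t)) / flat 0 (flat 0 1).

Lemma step_ge0 t : 0 <= step t.
Proof. by rewrite divr_ge0// flat_ge0. Qed.

Lemma step_le1 t : step t <= 1.
Proof.
rewrite ler_pdivrMr ?flat_gt0// mul1r; apply: flat0_homo.
by rewrite gerBl flat_ge0.
Qed.

Lemma step0 t : t <= 0 -> step t = 0.
Proof.
move=> t0; rewrite /step flat_le0 ?mul0r// subr_le0.
by apply: flat0_homo; rewrite lerBrDl gerDr.
Qed.

Lemma step1 t : 1 <= t -> step t = 1.
Proof.
move=> t1; rewrite /step (@flat_le0 0 (1 - t)) ?subr_le0// subr0.
by rewrite divff// gt_eqF// !flat_gt0.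
Qed.

Lemma Ck_step n k (U : set 'rV[R]_n) q : open U ->
  Ck k U q -> Ck k U (step \o q).
Proof.
move=> oU Cq.
have C1 := CkD oU (Ck_cst k U 1) (CkM oU (Ck_cst k U (-1)) Cq).
have C2 := CkM oU (Ck_cst k U (-1)) (Ck_flat 0 oU C1).
have C3 := Ck_flat 0 oU (CkD oU (Ck_cst k U (flat 0 1)) C2).
have := CkM oU C3 (Ck_cst k U (flat 0 (flat 0 1))^-1).
by apply: Ck_eq => // x _ /=; rewrite !mulN1r.
Qed.

End FlatFunction.

Local Obligation Tactic := idtac.

Section Diffeology.
Variable R : realType.

(* A parameterization U -> X is represented by a total function 'rV_n -> X of
   which only the restriction to U matters: plot_local, applied with V = U,
   shows that being a plot depends only on the values on U. *)
Record diffeology (X : Type) := Diffeology {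
  plot : forall n, set 'rV[R]_n -> ('rV[R]_n -> X) -> Prop;
  plot_open : forall n (U : set 'rV[R]_n) p, plot U p -> open U;
  plot_cst : forall n (U : set 'rV[R]_n) x, open U -> plot U (fun=> x);
  plot_comp : forall n m (U : set 'rV[R]_n) (V : set 'rV[R]_m) p f,
    plot U p -> open V -> smooth_param V f -> (forall x, V x -> U (f x)) ->
    plot V (p \o f);
  plot_local : forall n (U : set 'rV[R]_n) p, open U ->
    (forall x, U x -> exists (V : set 'rV[R]_n) q,
      [/\ V x, V `<=` U, plot V q & {in V, q =1 p}]) ->
    plot U p }.

Arguments plot {X} d {n} U p.

(* The carrier is a choiceType so that quotients and topologies can be put on
   it; classically this is no restriction. *)
Record diffSpace := DiffSpace {
  carrier :> choiceType;
  diffeo : diffeology carrier }.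

Record smooth_map (X Y : diffSpace) := SmoothMap {
  smooth_fun :> X -> Y;
  smoothP : forall n (U : set 'rV[R]_n) p,
    plot (diffeo X) U p -> plot (diffeo Y) U (smooth_fun \o p) }.

Definition smooth_id X : smooth_map X X := @SmoothMap X X idfun (fun n U p Up => Up).

Definition smooth_comp X Y Z (g : smooth_map Y Z) (f : smooth_map X Y) :
    smooth_map X Z :=
  @SmoothMap X Z (g \o f) (fun n U p Up => smoothP g (smoothP f Up)).

Lemma plot_eq X (d : diffeology X) n (U : set 'rV[R]_n) p q :
  {in U, p =1 q} -> plot d U p -> plot d U q.
Proof.
move=> pq Up; apply: (plot_local (plot_open Up)) => x Ux.
by exists U, p; split.
Qed.

Lemma plot_sub X (d : diffeology X) n (U V : set 'rV[R]_n) p :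
  open V -> V `<=` U -> plot d U p -> plot d V p.
Proof.
move=> oV VU Up; apply: (plot_comp (f := id) Up) => //.
by move=> j k; exact: Ck_coord.
Qed.

Program Definition real_diffeology : diffeology R :=
  @Diffeology R (fun n U p => open U /\ smooth_fct U p) _ _ _ _.
Next Obligation. by move=> n U p []. Qed.
Next Obligation. by move=> n U x oU; split=> // k; exact: Ck_cst. Qed.
Next Obligation.
move=> n m U V p f [oU sp] oV sf VU; split=> //.
exact: (smooth_fct_comp oV oU VU sf sp).
Qed.
Next Obligation.
move=> n U p oU H; split=> //; apply: smooth_fct_local => // x.
by move=> /H[V [q [Vx VU [oV sq] qp]]]; exists V, q; split.
Qed.

Definition real_line : diffSpace := DiffSpace real_diffeology.

Program Definition euclidean_diffeology m : diffeology 'rV[R]_m :=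
  @Diffeology 'rV[R]_m (fun n U p => open U /\ smooth_param U p) _ _ _ _.
Next Obligation. by move=> m n U p []. Qed.
Next Obligation.
by move=> m n U x oU; split=> // j k; exact: Ck_cst.
Qed.
Next Obligation.
move=> d n m U V p f [oU sp] oV sf VU; split=> // j.
exact: (smooth_fct_comp oV oU VU sf (sp j)).
Qed.
Next Obligation.
move=> m n U p oU H; split=> // j; apply: smooth_fct_local => // x.
move=> /H[V [q [Vx VU [oV sq] qp]]]; exists V, (fun y => q y 0 j).
by split=> // y Vy; rewrite qp.
Qed.

Definition euclidean m : diffSpace := DiffSpace (euclidean_diffeology m).

Program Definition sub_diffeology (X : diffSpace) (P : pred X) :
    diffeology {x : X | P x} :=
  @Diffeology _ (fun n U p => plot (diffeo X) U (fun x => val (p x))) _ _ _ _.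
Next Obligation. by move=> X P n U p /plot_open. Qed.
Next Obligation. by move=> X P n U x oU; exact: plot_cst. Qed.
Next Obligation.
by move=> X P n m U V p f Up oV sf VU; exact: (plot_comp Up oV sf VU).
Qed.
Next Obligation.
move=> X P n U p oU H; apply: plot_local => // x /H[V [q [Vx VU Vq qp]]].
by exists V, (fun y => val (q y)); split=> // y /qp ->.
Qed.

Definition sub_space (X : diffSpace) (P : pred X) : diffSpace :=
  DiffSpace (sub_diffeology P).

Program Definition prod_diffeology (X Y : diffSpace) : diffeology (X * Y) :=
  @Diffeology _ (fun n U p => plot (diffeo X) U (fun x => (p x).1) /\
    plot (diffeo Y) U (fun x => (p x).2)) _ _ _ _.
Next Obligation. by move=> X Y n U p [/plot_open]. Qed.
Next Obligation. by move=> X Y n U x oU; split; exact: plot_cst. Qed.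
Next Obligation.
move=> X Y n m U V p f [Up1 Up2] oV sf VU.
by split; [exact: (plot_comp Up1 oV sf VU)|exact: (plot_comp Up2 oV sf VU)].
Qed.
Next Obligation.
move=> X Y n U p oU H; split; apply: plot_local => // x.
- move=> /H[V [q [Vx VU [Vq _] qp]]]; exists V, (fun y => (q y).1).
  by split=> // y /qp ->.
- move=> /H[V [q [Vx VU [_ Vq] qp]]]; exists V, (fun y => (q y).2).
  by split=> // y /qp ->.
Qed.

Definition prod_space (X Y : diffSpace) : diffSpace :=
  DiffSpace (prod_diffeology X Y).

Local Open Scope quotient_scope.

(* The plots are the parameterizations that lift locally to plots of X;
   quotient_proj and quotient_diffeology_finest show that this is the finest
   diffeology for which the projection is smooth. *)
Program Definition quotient_diffeology (X : diffSpace) (e : equiv_rel X) :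
    diffeology {eq_quot e} :=
  @Diffeology _ (fun n U p => open U /\
    forall x, U x -> exists (V : set 'rV[R]_n) q,
    [/\ V x, V `<=` U, plot (diffeo X) V q & {in V, \pi_{eq_quot e} \o q =1 p}])
    _ _ _ _.
Next Obligation. by move=> X e n U p []. Qed.
Next Obligation.
move=> X e n U x oU; split=> // y Uy; exists U, (fun=> repr x).
by split=> //; [exact: plot_cst|move=> z _ /=; rewrite reprK].
Qed.
Next Obligation.
move=> X e n m U V p f [oU Up] oV sf VU; split=> // x Vx.
have [W [q [Wfx WU Wq qp]]] := Up _ (VU _ Vx).
have oW := plot_open Wq.
have oV' : open (V `&` f @^-1` W).
  rewrite openE => y [Vy Wy]; apply: filterI; first exact: open_nbhs_nbhs.
  apply: (smooth_param_continuous oV sf); first by rewrite inE.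
  exact: open_nbhs_nbhs.
exists (V `&` f @^-1` W), (q \o f); split=> //.
- apply: (plot_comp Wq oV') => [j|y []//].
  by move=> k; apply: Ck_within (sf j k).
- by move=> y; rewrite inE => -[_ Wy]; rewrite -[RHS]qp// inE.
Qed.
Next Obligation.
move=> X e n U p oU H; split=> // x /H[V [q [Vx VU [oV Vq] qp]]].
have [W [r [Wx WV Wr rq]]] := Vq _ Vx.
exists W, r; split=> //; first exact: subset_trans VU.
move=> y Wy; rewrite rq// qp//; move: Wy; rewrite !inE; exact: WV.
Qed.

Definition quotient_space (X : diffSpace) (e : equiv_rel X) : diffSpace :=
  DiffSpace (quotient_diffeology e).

Program Definition quotient_proj (X : diffSpace) (e : equiv_rel X) :
    smooth_map X (quotient_space e) :=
  @SmoothMap X (quotient_space e) (\pi_{eq_quot e}) _.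
Next Obligation.
move=> X e n U p Up; split; first exact: plot_open Up.
by move=> x Ux; exists U, p; split.
Qed.

Lemma quotient_diffeology_finest (X : diffSpace) (e : equiv_rel X)
    (d : diffeology {eq_quot e}) :
  (forall n (U : set 'rV[R]_n) p,
    plot (diffeo X) U p -> plot d U (\pi_{eq_quot e} \o p)) ->
  forall n (U : set 'rV[R]_n) p,
    plot (quotient_diffeology e) U p -> plot d U p.
Proof.
move=> H n U p [oU Up]; apply: plot_local => // x /Up[V [q [Vx VU Vq qp]]].
by exists V, (\pi_{eq_quot e} \o q); split=> //; exact: H.
Qed.

(* The underlying space of the functor T: its open sets are those whose preimage
   under every plot is open, that is, the final topology for the plots. *)
Definition Dtop (X : diffSpace) : Type := X.

HB.instance Definition _ (X : diffSpace) := Choice.on (Dtop X).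

Definition Dtop_open (X : diffSpace) (A : set (Dtop X)) : Prop :=
  forall n (U : set 'rV[R]_n) p, plot (diffeo X) U p -> open (U `&` p @^-1` A).

Lemma Dtop_openT X : @Dtop_open X setT.
Proof. by move=> n U p /plot_open; rewrite preimage_setT setIT. Qed.

Lemma Dtop_openI X (A B : set (Dtop X)) :
  Dtop_open A -> Dtop_open B -> Dtop_open (A `&` B).
Proof.
move=> oA oB n U p Up; rewrite preimage_setI setIIr.
by apply: openI; [exact: oA|exact: oB].
Qed.

Lemma Dtop_open_bigU X (I : Type) (A : I -> set (Dtop X)) :
  (forall i, Dtop_open (A i)) -> Dtop_open (\bigcup_i A i).
Proof.
move=> oA n U p Up; rewrite preimage_bigcup setI_bigcupr.
by apply: bigcup_open => i _; exact: oA.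
Qed.

HB.instance Definition _ (X : diffSpace) := isOpenTopological.Build (Dtop X)
  (@Dtop_openT X) (@Dtop_openI X) (@Dtop_open_bigU X).

Lemma DtopE (X : diffSpace) : open = @Dtop_open X.
Proof. by []. Qed.

Program Definition continuous_diffeology (Y : topologicalType) : diffeology Y :=
  @Diffeology Y (fun n U p => open U /\ {within U, continuous p}) _ _ _ _.
Next Obligation. by move=> Y n U p []. Qed.
Next Obligation.
by move=> Y n U y oU; split=> //; apply: continuous_subspaceT; exact: cst_continuous.
Qed.
Next Obligation.
move=> Y n m U V p f [oU cp] oV sf VU; split=> //; move: cp.
rewrite !continuous_open_subspace// => cp x Vx.
apply: continuous_comp; first exact: (smooth_param_continuous oV sf).
by apply: cp; move: Vx; rewrite !inE; exact: VU.
Qed.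
Next Obligation.
move=> Y n U p oU H; split=> //; rewrite continuous_open_subspace// => x.
rewrite inE => /H[V [q [Vx VU [oV cq] qp]]].
have : {within V, continuous p} by exact: subspace_eq_continuous qp cq.
by rewrite continuous_open_subspace// => /(_ x); rewrite inE; exact.
Qed.

Definition Dspace (Y : topologicalType) : diffSpace :=
  DiffSpace (continuous_diffeology Y).

Program Definition DT_unit (X : diffSpace) : smooth_map X (Dspace (Dtop X)) :=
  @SmoothMap X (Dspace (Dtop X)) idfun _.
Next Obligation.
move=> X n U p Up; have oU := plot_open Up; split=> //.
rewrite continuous_open_subspace// => x; rewrite inE => Ux A /=.
rewrite nbhsE => -[B [oB Bx] BA].
have /= oUB := oB _ _ _ Up.
apply: filterS (open_nbhs_nbhs (conj oUB (conj Ux Bx))).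
by move=> y [_ /BA].
Qed.

(* The adjunction between Dtop (T) and Dspace (D), i.e. the universal property of the final
   topology. *)
Lemma Dtop_adjunction (X : diffSpace) (Y : topologicalType) (g : X -> Y) :
  continuous (g : Dtop X -> Y) <->
  forall n (U : set 'rV[R]_n) p,
    plot (diffeo X) U p -> plot (diffeo (Dspace Y)) U (g \o p).
Proof.
split=> [cg n U p Up|H].
  have [oU] := smoothP (DT_unit X) Up.
  rewrite continuous_open_subspace// => cp.
  split=> //; rewrite continuous_open_subspace// => x Ux.
  by apply: (continuous_comp (cp x Ux)); exact: cg.
apply/continuousP => A oA; rewrite DtopE => n U p Up.
have [oU] := H _ _ _ Up.
rewrite continuous_open_subspace// => cgp; rewrite openE => x [Ux Ax].
apply: filterI; first exact: open_nbhs_nbhs.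
by apply: (cgp x); [rewrite inE|exact: open_nbhs_nbhs].
Qed.

Definition unit_interval : diffSpace :=
  @sub_space real_line (fun t : R => 0 <= t <= 1).

Fact in_unit0 : 0 <= (0 : R) <= 1. Proof. by rewrite lexx ler01. Qed.
Fact in_unit1 : 0 <= (1 : R) <= 1. Proof. by rewrite lexx ler01. Qed.

Definition I0 : unit_interval := exist _ 0 in_unit0.
Definition I1 : unit_interval := exist _ 1 in_unit1.

Definition cube n : diffSpace :=
  @sub_space (euclidean n) (fun x : 'rV[R]_n => [forall i, 0 <= x 0 i <= 1]).

Definition cube_boundary n (s : cube n) : Prop :=
  exists i, val s 0 i = 0 \/ val s 0 i = 1.

Definition homotopic (X Y : diffSpace) (f0 f1 : smooth_map X Y) : Prop :=
  exists F : smooth_map (prod_space X unit_interval) Y,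
    (forall x, F (x, I0) = f0 x) /\ (forall x, F (x, I1) = f1 x).

Definition homotopy_equivalence (X Y : diffSpace) (f : smooth_map X Y) : Prop :=
  exists g : smooth_map Y X,
    homotopic (smooth_comp g f) (smooth_id X) /\
    homotopic (smooth_comp f g) (smooth_id Y).

Definition homotopy_equivalent (X Y : diffSpace) : Prop :=
  exists f : smooth_map X Y, homotopy_equivalence f.

Record pair_map n (X : diffSpace) (x0 : X) := PairMap {
  pair_smooth :> smooth_map (cube n) X;
  pair_boundary : forall s, cube_boundary s -> pair_smooth s = x0 }.

HB.instance Definition _ n (X : diffSpace) (x0 : X) := gen_eqMixin (pair_map n x0).
HB.instance Definition _ n (X : diffSpace) (x0 : X) := gen_choiceMixin (pair_map n x0).

Definition pair_homotopic n (X : diffSpace) (x0 : X) (f0 f1 : pair_map n x0) :=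
  exists F : smooth_map (prod_space (cube n) unit_interval) X,
    [/\ forall s, F (s, I0) = f0 s, forall s, F (s, I1) = f1 s &
        forall s t, cube_boundary s -> F (s, t) = x0].

Lemma unit_step (t : R) : 0 <= step t <= 1.
Proof. by rewrite step_ge0 step_le1. Qed.

Definition step_unit (t : R) : unit_interval := exist _ (step t) (unit_step t).

Lemma step_unit0 t : t <= 0 -> step_unit t = I0.
Proof. by move=> t0; apply: val_inj; rewrite /= step0. Qed.

Lemma step_unit1 t : 1 <= t -> step_unit t = I1.
Proof. by move=> t1; apply: val_inj; rewrite /= step1. Qed.

Lemma open_smooth_lt n (U : set 'rV[R]_n) (f : 'rV[R]_n -> R) c :
  open U -> smooth_fct U f -> open (U `&` [set x | f x < c]).
Proof.
move=> oU /(_ 0); rewrite /= continuous_open_subspace// => cf.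
rewrite openE => x [Ux fx]; apply: filterI; first exact: open_nbhs_nbhs.
have /cvgr_lt : f y @[y --> x] --> f x by apply: cf; rewrite inE.
exact.
Qed.

Lemma open_smooth_gt n (U : set 'rV[R]_n) (f : 'rV[R]_n -> R) c :
  open U -> smooth_fct U f -> open (U `&` [set x | c < f x]).
Proof.
move=> oU /(_ 0); rewrite /= continuous_open_subspace// => cf.
rewrite openE => x [Ux fx]; apply: filterI; first exact: open_nbhs_nbhs.
have /cvgr_gt : f y @[y --> x] --> f x by apply: cf; rewrite inE.
exact.
Qed.

Section Concatenation.
Variables X Y : diffSpace.
Variables F G : smooth_map (prod_space X unit_interval) Y.
Hypothesis FG : forall x, F (x, I1) = G (x, I0).

Let H (z : prod_space X unit_interval) : Y :=
  if val z.2 <= 2^-1 then F (z.1, step_unit (3 * val z.2))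
  else G (z.1, step_unit (3 * val z.2 - 2)).

Let H_lt z : val z.2 < 2 / 3 -> H z = F (z.1, step_unit (3 * val z.2)).
Proof.
move=> z1; rewrite /H; case: leP => // z2.
rewrite step_unit0; last by lra.
by rewrite step_unit1; last by lra.
Qed.

Let H_gt z : 1 / 3 < val z.2 -> H z = G (z.1, step_unit (3 * val z.2 - 2)).
Proof.
move=> z1; rewrite /H; case: leP => // z2.
rewrite step_unit1; last by lra.
by rewrite step_unit0; last by lra.
Qed.

Let H_smooth n (U : set 'rV[R]_n) p :
  plot (diffeo (prod_space X unit_interval)) U p -> plot (diffeo Y) U (H \o p).
Proof.
move=> [Up1 [oU Up2]]; apply: plot_local => // x Ux.
set q := fun x => val (p x).2 in Up2.
have step_plot V a b : open V -> V `<=` U ->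
    plot (diffeo (prod_space X unit_interval)) V
      (fun y => ((p y).1, step_unit (a * q y + b))).
  move=> oV VU; split; first exact: plot_sub VU Up1.
  split=> // k; apply: Ck_step => //.
  apply: CkD (Ck_cst _ _ _) => //; apply: CkM (Ck_cst _ _ _) _ => //.
  exact: Ck_within (Up2 k).
have [qx|qx] := ltP (q x) (2 / 3).
- pose V := U `&` [set y | q y < 2 / 3].
  have VU : V `<=` U by move=> y [].
  have oV : open V by exact: open_smooth_lt.
  exists V, (F \o (fun y => ((p y).1, step_unit (3 * q y + 0)))); split=> //.
    exact: (smoothP F (step_plot V 3 0 oV VU)).
  by move=> y; rewrite inE => -[_ qy] /=; rewrite H_lt// addr0.
- pose V := U `&` [set y | 1 / 3 < q y].
  have VU : V `<=` U by move=> y [].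
  have oV : open V by exact: open_smooth_gt.
  exists V, (G \o (fun y => ((p y).1, step_unit (3 * q y + - 2)))); split=> //.
  + by split=> //=; lra.
  + exact: (smoothP G (step_plot V 3 (- 2) oV VU)).
  + by move=> y; rewrite inE => -[_ qy] /=; rewrite H_gt.
Qed.

Lemma homotopy_concat :
  exists K : smooth_map (prod_space X unit_interval) Y,
    [/\ forall x, K (x, I0) = F (x, I0), forall x, K (x, I1) = G (x, I1) &
      forall x t, exists t',
        K (x, t) = F (x, t') \/ K (x, t) = G (x, t')].
Proof.
exists (SmoothMap H_smooth); split=> [x|x|x t] /=.
- by rewrite H_lt/= ?step_unit0//; lra.
- by rewrite H_gt/= ?step_unit1//; lra.
- rewrite /H; case: ifP => _; eexists; [by left|by right].
Qed.

End Concatenation.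

Lemma unit_onem (t : unit_interval) : 0 <= 1 - val t <= 1.
Proof. by case: t => /= t /andP[? ?]; apply/andP; split; lra. Qed.

Definition onem_unit (t : unit_interval) : unit_interval :=
  exist _ (1 - val t) (unit_onem t).

Program Definition homotopy_reverse X Y
    (F : smooth_map (prod_space X unit_interval) Y) :
    smooth_map (prod_space X unit_interval) Y :=
  @SmoothMap _ _ (fun z => F (z.1, onem_unit z.2)) _.
Next Obligation.
move=> X Y F n U p [Up1 [oU Up2]].
have Up : plot (diffeo (prod_space X unit_interval)) U
    (fun x => ((p x).1, onem_unit (p x).2)).
  split=> //; split=> //= k.
  have := CkD oU (Ck_cst k U 1) (CkM oU (Ck_cst k U (-1)) (Up2 k)).
  by apply: Ck_eq => // x _ /=; rewrite mulN1r.
exact: (smoothP F Up).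
Qed.

Program Definition homotopy_cst X Y (f : smooth_map X Y) :
    smooth_map (prod_space X unit_interval) Y :=
  SmoothMap (smooth_fun := fun z => f z.1) _.
Next Obligation. by move=> X Y f n U p [Up1 _]; exact: (smoothP f Up1). Qed.

Lemma pair_homotopic_refl n (X : diffSpace) (x0 : X) (f : pair_map n x0) : pair_homotopic f f.
Proof.
by exists (homotopy_cst f); split=> // s t; exact: pair_boundary.
Qed.

Lemma pair_homotopic_sym n (X : diffSpace) (x0 : X) (f g : pair_map n x0) :
  pair_homotopic f g -> pair_homotopic g f.
Proof.
move=> [F [F0 F1 Fb]]; exists (homotopy_reverse F); split=> [s|s|s t bs] /=.
- by rewrite -F1; congr (F (_, _)); apply: val_inj; rewrite /= subr0.
- by rewrite -F0; congr (F (_, _)); apply: val_inj; rewrite /= subrr.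
- exact: Fb.
Qed.

Lemma pair_homotopic_trans n (X : diffSpace) (x0 : X) (f g h : pair_map n x0) :
  pair_homotopic f g -> pair_homotopic g h -> pair_homotopic f h.
Proof.
move=> [F [F0 F1 Fb]] [G [G0 G1 Gb]].
have FG s : F (s, I1) = G (s, I0) by rewrite F1 G0.
have [K [K0 K1 Kb]] := homotopy_concat FG.
exists K; split=> [s|s|s t bs]; rewrite ?K0 ?K1//.
by have [t' [->|->]] := Kb s t; [exact: Fb|exact: Gb].
Qed.

Definition pair_homotopicb n (X : diffSpace) (x0 : X) (f g : pair_map n x0) : bool :=
  `[< pair_homotopic f g >].

Lemma pair_homotopic_equiv n (X : diffSpace) (x0 : X) :
  equiv_class_of (@pair_homotopicb n X x0).
Proof.
split=> [f|f g|g f h].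
- exact/asboolP/pair_homotopic_refl.
- by apply/asboolP/asboolP; exact: pair_homotopic_sym.
- move=> /asboolP fg /asboolP gh; apply/asboolP.
  exact: pair_homotopic_trans fg gh.
Qed.

Canonical pair_homotopic_equiv_rel n (X : diffSpace) (x0 : X) :=
  EquivRelPack (@pair_homotopic_equiv n X x0).

Definition homotopy_set n (X : diffSpace) (x0 : X) : Type :=
  {eq_quot (@pair_homotopicb n X x0)}.

Definition pair_push n (X Y : diffSpace) (f : smooth_map X Y) (x0 : X)
    (a : pair_map n x0) : pair_map n (f x0) :=
  PairMap (pair_smooth := smooth_comp f a)
    (fun s bs => congr1 f (pair_boundary a bs)).

(* The map f_* on pi_n; homotopy_set_mapE shows that it does not depend on the
   chosen representative. *)
Definition homotopy_set_map n (X Y : diffSpace) (f : smooth_map X Y) (x0 : X)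
    (c : homotopy_set n x0) : homotopy_set n (f x0) :=
  \pi_{eq_quot (@pair_homotopicb n Y (f x0))} (pair_push f (repr c)).

Lemma homotopy_set_mapE n (X Y : diffSpace) (f : smooth_map X Y) (x0 : X)
    (a : pair_map n x0) :
  homotopy_set_map f (\pi_{eq_quot (@pair_homotopicb n X x0)} a) =
  \pi_{eq_quot (@pair_homotopicb n Y (f x0))} (pair_push f a).
Proof.
have /eqmodP /asboolP [F [F0 F1 Fb]] :
  repr (\pi_{eq_quot (@pair_homotopicb n X x0)} a) = a
    %[mod {eq_quot (@pair_homotopicb n X x0)}] by rewrite reprK.
apply/eqmodP/asboolP; exists (smooth_comp f F).
by split=> [s|s|s t bs] /=; rewrite ?F0 ?F1 ?Fb.
Qed.

Definition weak_equivalence (X Y : diffSpace) (f : smooth_map X Y) : Prop :=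
  forall (x : X) (n : nat), bijective (@homotopy_set_map n X Y f x).

Definition int_lattice : {pred 'rV[R]_2} :=
  fun v => [forall i, v 0 i \is a Num.int].

Fact int_lattice_zmod_closed : zmod_closed int_lattice.
Proof.
split=> [|u v /forallP Zu /forallP Zv]; first by apply/forallP => i; rewrite mxE.
by apply/forallP => i; rewrite !mxE rpredB.
Qed.

HB.instance Definition _ :=
  GRing.isZmodClosed.Build 'rV[R]_2 int_lattice int_lattice_zmod_closed.

(* R^2 / Z^2, the group structure being that of the additive quotient; the
   library notation {ideal_quot _} makes sense for any additive subgroup. *)
Definition torus : diffSpace :=
  @quotient_space (euclidean 2) (Quotient.equiv_equiv int_lattice).

Definition torus_line (theta : R) : {pred {ideal_quot int_lattice}} :=
  fun z => `[< exists t : R,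
    z = \pi_{ideal_quot int_lattice} (\row_(i < 2) [:: t; theta * t]`_i) >].

Fact torus_line_zmod_closed theta : zmod_closed (torus_line theta).
Proof.
split=> [|_ _ /asboolP[s ->] /asboolP[t ->]]; apply/asboolP.
- exists 0; rewrite -(raddf0 (\pi_{ideal_quot int_lattice})).
  congr (\pi_{ideal_quot int_lattice} _).
  by apply/rowP; case=> -[|[|//]] ?; rewrite !mxE ?mulr0.
- exists (s - t); rewrite -raddfB; congr (\pi_{ideal_quot int_lattice} _).
  by apply/rowP; case=> -[|[|//]] ?; rewrite !mxE ?mulrBr.
Qed.

HB.instance Definition _ theta :=
  GRing.isZmodClosed.Build {ideal_quot int_lattice} (torus_line theta)
    (torus_line_zmod_closed theta).

Definition irrational_torus (theta : R) : diffSpace :=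
  @quotient_space torus (Quotient.equiv_equiv (torus_line theta)).

End Diffeology.

Arguments plot {R X} d {n} U p.

(* Main.v *)
Require Import Defs.
From mathcomp Require Import all_boot all_order all_algebra.
From mathcomp Require Import ring lra.
From mathcomp Require Import all_classical all_reals all_analysis.
Import Order.TTheory GRing.Theory Num.Theory.
Import numFieldNormedType.Exports.

(** The irrational torus is, as a diffeological space, the quotient of the line
    by the countable group Z + theta Z: every point is the class [torus_pt r] of
    some [(0, r)], and plots lift locally to smooth functions ([torus_pt_eq],
    [torus_plot_lift], [torus_pt_plot]).

    As this group is countable, two continuous lifts of the same map on a
    segment differ by a constant ([countable_valued_cst]). Local lifts of a
    homotopy can therefore be glued to a lift over the unit square
    ([lift_square]), and when the homotopy consists of closed loops, the
    increment of the lift along these loops is the same at both ends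
    ([lift_holonomy]). So the loop [t |-> torus_pt t], whose lift has
    increment 1, is not homotopic to a constant loop ([no_null_homotopy]).

    As the group is dense ([slope_group_dense]), the D-topology of the
    irrational torus is indiscrete ([torus_indiscrete]), and all
    parameterizations are plots of [D T] of it. Hence the image of this loop in
    [D T] is null-homotopic, and the unit is not injective on the fundamental
    group. Similarly, if [f] and [g] were inverse homotopy equivalences with a
    space [D Y], then [g \o f] would send every parameterization to a plot.
    Since a lift with countably many values is constant, so is [g \o f]
    ([all_plots_cst]), and the homotopy from [g \o f] to the identity would
    again contract the loop. *)

Set Implicit Arguments.
Unset Strict Implicit.
Unset Printing Implicit Defensive.

Local Open Scope classical_set_scope.
Local Open Scope ring_scope.
Local Open Scope quotient_scope.

(** * Continuous functions on a segment *)

Section RealLine.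
Variable R : realType.
Implicit Types (a b c x y : R) (D : set R).

Lemma within_itv_sub a b a' b' (f : R -> R) : a <= a' -> b' <= b ->
  {within `[a, b], continuous f} -> {within `[a', b'], continuous f}.
Proof.
move=> aa bb; apply: continuous_subspaceW => x /=.
by rewrite !in_itv/= => /andP[? ?]; apply/andP; split; lra.
Qed.

Lemma within_eq a b (f g : R -> R) : (forall x, a <= x <= b -> f x = g x) ->
  {within `[a, b], continuous f} -> {within `[a, b], continuous g}.
Proof.
move=> fg; apply: subspace_eq_continuous => x.
by rewrite inE /= in_itv /=; exact: fg.
Qed.

Lemma within_glue a b c (f : R -> R) : a <= b -> b <= c ->
  {within `[a, b], continuous f} -> {within `[b, c], continuous f} ->
  {within `[a, c], continuous f}.
Proof.
move=> ab bc fab fbc.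
have fU : {within `[a, b] `|` `[b, c], continuous f}.
  by apply: withinU_continuous fab fbc; exact: interval_closed.
apply: continuous_subspaceW fU => x /=; rewrite !in_itv/= => /andP[ax xc].
by case: (leP x b) => xb; [left|right]; rewrite ?ax// xc (ltW xb).
Qed.

Lemma within_subr a b (f g : R -> R) :
  {within `[a, b], continuous f} -> {within `[a, b], continuous g} ->
  {within `[a, b], continuous (fun x => f x - g x)}.
Proof. by move=> cf cg x; apply: cvgB; [exact: cf|exact: cg]. Qed.

Lemma within_addrC a b (f : R -> R) k : {within `[a, b], continuous f} ->
  {within `[a, b], continuous (fun x => f x + k)}.
Proof. by move=> cf x; apply: cvgD; [exact: cf|exact: cvg_cst]. Qed.

Lemma countable_itv_le a b D : countable D ->
  (forall x, a <= x <= b -> D x) -> b <= a.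
Proof.
move=> cD abD; rewrite leNgt; apply/negP => ab.
have /countable_lebesgue_measure0 : countable (`[a, b] : set R).
  apply: sub_countable cD; apply: subset_card_le => x /=.
  by rewrite in_itv/=; exact: abD.
rewrite lebesgue_measure_itv /= lte_fin ab -EFinB => /eqP.
by rewrite eqe subr_eq0 (gt_eqF ab).
Qed.

Lemma countable_shift D r : countable D ->
  countable [set s | D (s - r)].
Proof.
apply: sub_countable; apply: card_le_trans (card_image_le (+%R^~ r) D).
by apply: subset_card_le => s /= Ds; exists (s - r) => //; rewrite subrK.
Qed.

(** A nonconstant continuous function takes all the values of a segment, hence
    uncountably many. *)
Lemma countable_valued_cst a b (f : R -> R) D : countable D -> a <= b ->
  {within `[a, b], continuous f} -> (forall x, a <= x <= b -> D (f x)) ->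
  f a = f b.
Proof.
move=> cD ab cf fD.
suff E : Num.max (f a) (f b) <= Num.min (f a) (f b).
  by move: E; rewrite ge_max !le_min => /andP[/andP[_ ?] /andP[? _]];
    apply/le_anti/andP.
apply: (countable_itv_le cD) => v vab.
have [x] := IVT ab cf vab.
by rewrite in_itv/= => xab <-; exact: fD.
Qed.

(** Cousin's lemma: a property of segments that is additive, and holds for all
    small segments around each point, holds for the whole segment. *)
Lemma cousin (Q : R -> R -> Prop) a b : a <= b ->
  (forall x y z, x <= y -> y <= z -> Q x y -> Q y z -> Q x z) ->
  (forall x, a <= x <= b -> exists2 e, 0 < e & forall y z,
     x - e < y -> y <= x -> x <= z -> z < x + e -> Q y z) ->
  Q a b.
Proof.
move=> ab Qadd Qloc.
pose S := [set t | a <= t <= b /\ Q a t].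
have Sa : S a.
  split; first by rewrite lexx.
  have [|e e0 He] := Qloc a; first by rewrite lexx.
  by apply: He; lra.
have bS : has_ubound S by exists b => t [/andP[]].
have hS : has_sup S by split=> //; exists a.
pose s := sup S.
have as_ : a <= s by exact: ub_le_sup.
have sb : s <= b by apply: ge_sup; [exists a|move=> t [/andP[]]].
have [|e e0 He] := Qloc s; first by rewrite as_.
have [t [/andP[at_ tb] Qat] st] := sup_adherent e0 hS.
have ts : t <= s by apply: ub_le_sup => //; split=> //; rewrite at_.
have Qa z : s <= z -> z < s + e -> Q a z.
  by move=> sz ze; apply: (Qadd a t z) => //; [lra|exact: He].
have [bs|sb'] := leP b s; first by apply: Qa => //; lra.
pose z := Num.min b (s + e / 2).
have zb : z <= b by rewrite ge_min lexx.
have zs : z <= s + e / 2 by rewrite ge_min lexx orbT.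
have sz : s < z by rewrite lt_min sb'; lra.
have Sz : S z by split; [apply/andP; split=> //; lra|apply: Qa; lra].
by have := ub_le_sup bS Sz; rewrite leNgt sz.
Qed.

End RealLine.

(** * Lifting modulo a countable subgroup *)

Section Lifting.
Variables (R : realType) (D : set R).
Hypothesis D_countable : countable D.
Hypothesis D0 : D 0.
Hypothesis DB : forall x y, D x -> D y -> D (x - y).
Implicit Types (a b c d x y : R) (g phi : R -> R -> R).

(** [phi] lifts the class of [g] modulo the subgroup [D] over the rectangle
    [a, b] x [c, d]. Only separate continuity is asked of [phi]: comparing the
    sides of the rectangle uses nothing more, and it makes two lifts easy to
    glue along a common side. *)
Definition lift_on g a b c d phi :=
  [/\ forall x y, a <= x <= b -> c <= y <= d -> D (phi x y - g x y),
      forall y, c <= y <= d -> {within `[a, b], continuous (phi ^~ y)} &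
      forall x, a <= x <= b -> {within `[c, d], continuous (phi x)}].

Definition liftable g a b c d := exists phi, lift_on g a b c d phi.

Lemma liftable_swap g a b c d :
  liftable g a b c d -> liftable (fun x y => g y x) c d a b.
Proof.
move=> [phi [A B C]]; exists (fun x y => phi y x); split=> // x y *; exact: A.
Qed.

Let DN x : D x -> D (- x).
Proof. by move=> Dx; rewrite -sub0r; exact: DB. Qed.

Let DD x y : D x -> D y -> D (x + y).
Proof. by move=> Dx Dy; rewrite -(opprK y); apply: DB => //; exact: DN. Qed.

Lemma liftable_glue g a b e c d : a <= b -> b <= e -> c <= d ->
  liftable g a b c d -> liftable g b e c d -> liftable g a e c d.
Proof.
move=> ab be cd [f [fD fx fy]] [h [hD hx hy]].
have abb : a <= b <= b by rewrite ab lexx.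
have bbe : b <= b <= e by rewrite be lexx.
(* On the common side, f - h is continuous with values in the countable set D,
   so it is a constant k; correcting h by k makes the two lifts match. *)
pose k := f b c - h b c.
have Ddiff y : c <= y <= d -> D (f b y - h b y).
  move=> cyd; have := DB (fD _ _ abb cyd) (hD _ _ bbe cyd).
  by congr D; lra.
have kE y : c <= y <= d -> f b y = h b y + k.
  move=> /andP[cy yd].
  suff : f b c - h b c = f b y - h b y.
    by rewrite /k => ->; rewrite addrC subrK.
  apply: (@countable_valued_cst _ c y (fun y => f b y - h b y) D) => //.
  - apply: within_subr; apply: (within_itv_sub (lexx c) yd).
      exact: fy.
    exact: hy.
  - by move=> z /andP[cz zy]; apply: Ddiff; apply/andP; split; lra.
have Dk : D k by apply: Ddiff; rewrite lexx.
exists (fun x y => if x <= b then f x y else h x y + k); split.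
- move=> x y /andP[ax xe] cyd; case: leP => xb.
    by apply: fD => //; rewrite ax.
  by rewrite addrAC; apply: DD => //; apply: hD => //; rewrite xe (ltW xb).
- move=> y cyd; apply: (within_glue ab be).
  + apply: within_eq (fx y cyd) => x /andP[_ xb].
    by rewrite xb.
  + apply: within_eq (within_addrC (k := k) (hx y cyd)) => x /andP[bx _] /=.
    case: leP => // xb; have -> : x = b by apply/le_anti/andP.
    by rewrite kE.
- move=> x /andP[ax xe]; case: (leP x b) => xb; first by apply: fy; rewrite ax.
  by apply: within_addrC; apply: hy; rewrite xe (ltW xb).
Qed.

(** A map that lifts near every point lifts over the whole unit square: by
    Cousin's lemma in the second variable it lifts over thin strips around each
    vertical line, and then over the square by Cousin's lemma in the first. *)
Lemma lift_square g :
  (forall x y, 0 <= x <= 1 -> 0 <= y <= 1 -> exists2 e, 0 < e &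
    forall a b c d, x - e < a -> a <= x -> x <= b -> b < x + e ->
      y - e < c -> c <= y -> y <= d -> d < y + e -> liftable g a b c d) ->
  liftable g 0 1 0 1.
Proof.
move=> loc.
have strip x : 0 <= x <= 1 -> exists2 e, 0 < e & forall a b,
     x - e < a -> a <= x -> x <= b -> b < x + e -> liftable g a b 0 1.
  move=> x01.
  apply: (@cousin R (fun c d => exists2 e, 0 < e & forall a b,
    x - e < a -> a <= x -> x <= b -> b < x + e -> liftable g a b c d)) => //.
  - move=> p q r pq qr [e e0 He] [f f0 Hf].
    exists (Num.min e f); first by rewrite lt_min e0.
    have : Num.min e f <= f by rewrite ge_min lexx orbT.
    have : Num.min e f <= e by rewrite ge_min lexx.
    move: (Num.min e f) => m me mf a b xa ax xb bx.
    apply: (@liftable_swap (fun x y => g y x)); apply: (liftable_glue pq qr).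
    + exact: le_trans ax xb.
    + by apply: liftable_swap; apply: He; lra.
    + by apply: liftable_swap; apply: Hf; lra.
  - move=> y y01; have [e e0 He] := loc x y x01 y01.
    by exists e => // c d *; exists e => // a b *; exact: He.
apply: (@cousin R (fun a b => liftable g a b 0 1)) => //.
by move=> a b e ab be; exact: liftable_glue.
Qed.

(** If the two vertical sides agree modulo [D], a lift has the same increment
    along the bottom side and along the top side: the increment along the
    horizontal segment at height [y] is continuous in [y] and takes its values
    in [D]. *)
Lemma lift_holonomy g phi : lift_on g 0 1 0 1 phi ->
  (forall y, 0 <= y <= 1 -> D (g 1 y - g 0 y)) ->
  phi 1 0 - phi 0 0 = phi 1 1 - phi 0 1.
Proof.
have i0 : 0 <= (0 : R) <= 1 by rewrite lexx ler01.
have i1 : 0 <= (1 : R) <= 1 by rewrite lexx ler01.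
move=> [pD px py] gD.
apply: (@countable_valued_cst R 0 1 (fun y => phi 1 y - phi 0 y) _
  D_countable) => //.
  by apply: within_subr; exact: py.
move=> y y01.
have := DD (DB (pD _ _ i1 y01) (pD _ _ i0 y01)) (gD _ y01).
by congr D; lra.
Qed.

End Lifting.

(** * The group Z + theta Z *)

Section Density.
Variable R : realType.
Variable theta : R.

(** The subgroup of the reals generated by 1 and [theta]. *)
Definition slope_group : set R :=
  [set r | exists m n : int, r = m%:~R + theta * n%:~R].

Lemma slope_group_countable : countable slope_group.
Proof.
pose h (p : int * int) : R := p.1%:~R + theta * p.2%:~R.
have : countable (h @` setT).
  exact: sub_countable (card_image_le _ _) (countableP _).
apply: sub_countable; apply: subset_card_le => r [m [n ->]].
by exists (m, n).
Qed.

Lemma slope_groupB x y : slope_group x -> slope_group y -> slope_group (x - y).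
Proof.
move=> [m [n ->]] [m' [n' ->]]; exists (m - m'), (n - n').
by rewrite !rmorphB /=; ring.
Qed.

Lemma slope_group_int (m : int) : slope_group m%:~R.
Proof. by exists m, 0; rewrite mulr0 addr0. Qed.

Lemma slope_group0 : slope_group 0. Proof. exact: (slope_group_int 0). Qed.

Lemma slope_groupMz x (k : int) : slope_group x -> slope_group (k%:~R * x).
Proof.
move=> [m [n ->]]; exists (k * m), (k * n); rewrite !rmorphM /=; ring.
Qed.

Hypothesis htheta : irrational theta.

(** Otherwise the positive elements have a positive infimum [m], which belongs
    to the group and generates it; 1 and [theta] would then be commensurable. *)
Lemma slope_group_small e : 0 < e -> exists2 r, slope_group r & 0 < r < e.
Proof.
move=> e0; apply: contrapT => H.
pose S := [set r | slope_group r /\ 0 < r].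
have S1 : S 1 by split; [exact: (slope_group_int 1)|exact: ltr01].
have lS : lbound S e.
  move=> r [Gr r0]; rewrite leNgt; apply/negP => re.
  by apply: H; exists r => //; rewrite r0.
have hS : has_inf S by split; [exists 1|exists e].
pose m := inf S.
have em : e <= m by apply: lb_le_inf => //; exists 1.
have m0 : 0 < m by lra.
have lm r : S r -> m <= r by apply: ge_inf; exists e.
have Sm : S m.
  have [r Sr rm] := inf_adherent m0 hS.
  have := lm _ Sr; rewrite le_eqVlt => /predU1P[->//|mr].
  have [r' Sr' rm'] : exists2 r', S r' & r' < m + (r - m).
    by apply: inf_adherent => //; rewrite subr_gt0.
  have mr' := lm _ Sr'.
  have : S (r - r').
    by split; [apply: slope_groupB; [case: Sr|case: Sr']|rewrite subr_gt0; lra].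
  by move=> /lm; rewrite -/m in rm; lra.
have mul r : slope_group r -> exists k : int, r = k%:~R * m.
  move=> Gr; exists (Num.floor (r / m)).
  have /andP[k1 k2] := real_floor_itv (num_real (r / m)).
  move: k1 k2; rewrite ler_pdivlMr// ltr_pdivrMr// intrD mulrDl mul1r.
  set k := Num.floor _ => k1 k2.
  have [//|kr] : k%:~R * m = r \/ k%:~R * m < r.
    by move: k1; rewrite le_eqVlt => /predU1P[->|]; [left|right].
  have : S (r - k%:~R * m).
    split; last by rewrite subr_gt0.
    by apply: slope_groupB => //; apply: slope_groupMz; case: Sm.
  by move=> /lm; lra.
have [a a1] := mul 1 (slope_group_int 1).
have [b bt] : exists k : int, theta = k%:~R * m.
  by apply: mul; exists 0, 1; rewrite add0r mulr1.
apply: htheta; exists (b%:~R / a%:~R); first by [].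
rewrite fmorph_div/= !ratr_int bt; apply: canLR (mulfK _) _ => //.
  by apply/eqP => a0; move: a1; rewrite a0 mul0r => /eqP; rewrite oner_eq0.
by rewrite -mulrA [m * _]mulrC -a1 mulr1.
Qed.

Lemma slope_group_dense x e : 0 < e -> exists2 r, slope_group r & `|x - r| < e.
Proof.
move=> /slope_group_small[r Gr /andP[r0 re]].
exists ((Num.floor (x / r))%:~R * r); first exact: slope_groupMz.
have /andP[] := real_floor_itv (num_real (x / r)).
rewrite ler_pdivlMr// ltr_pdivrMr// intrD mulrDl mul1r => k1 k2.
by rewrite ger0_norm; lra.
Qed.

End Density.

(** * Plane points, smooth functions, quotients and constant maps *)

Section Preliminaries.
Variable R : realType.

(** The point of the plane with coordinates [x] and [y]. *)
Definition plane_pt (x y : R) : 'rV[R]_2 := \row_(i < 2) [:: x; y]`_i.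

Lemma plane_pt_0 x y : plane_pt x y 0 0 = x. Proof. by rewrite mxE. Qed.
Lemma plane_pt_1 x y : plane_pt x y 0 1 = y. Proof. by rewrite mxE. Qed.

Lemma ball_plane_pt x y x' y' e : `|x - x'| < e -> `|y - y'| < e ->
  ball (plane_pt x y) e (plane_pt x' y').
Proof.
move=> xe ye; split; first exact: le_lt_trans (normr_ge0 _) xe.
move=> i; rewrite ord1; case=> -[|[|//]] j; rewrite !mxE /=.
  exact: xe.
exact: ye.
Qed.

Lemma continuous_plane_ptl y : continuous (plane_pt^~ y).
Proof.
move=> x B /nbhs_ballP[e e0 eB]; apply/nbhs_ballP; exists e => // x' xx'.
by apply: eB; apply: ball_plane_pt; rewrite ?subrr ?normr0.
Qed.

Lemma continuous_plane_ptr x : continuous (plane_pt x).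
Proof.
move=> y B /nbhs_ballP[e e0 eB]; apply/nbhs_ballP; exists e => // y' yy'.
by apply: eB; apply: ball_plane_pt; rewrite ?subrr ?normr0.
Qed.

Lemma continuous_row1 : continuous (fun x : R => \row_(_ < 1) x).
Proof.
move=> x B /nbhs_ballP[e e0 eB]; apply/nbhs_ballP; exists e => // x' xx'.
by apply: eB; split=> // i j; rewrite !mxE.
Qed.

Lemma smooth_fct_continuous n (U : set 'rV[R]_n) (q : 'rV[R]_n -> R) x :
  open U -> smooth_fct U q -> U x -> {for x, continuous q}.
Proof.
move=> oU /(_ 0) /=; rewrite continuous_open_subspace// => cq Ux.
by apply: cq; rewrite inE.
Qed.

Lemma smooth_fct1_continuous (u : R -> R) :
  smooth_fct setT (fun v : 'rV[R]_1 => u (v 0 0)) -> continuous u.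
Proof.
move=> su x.
rewrite (_ : u = (fun v : 'rV[R]_1 => u (v 0 0)) \o (fun x => \row_(_ < 1) x)).
  apply: continuous_comp; first exact: continuous_row1.
  exact: smooth_fct_continuous openT su _.
by apply/funext => y /=; rewrite mxE.
Qed.

Lemma cst_smooth (X Y : diffSpace R) (y : Y) n (U : set 'rV[R]_n) p :
  plot (diffeo X) U p -> plot (diffeo Y) U ((fun=> y) \o p).
Proof. by move=> /plot_open oU; exact: plot_cst. Qed.

(** The constant map of pairs. *)
Definition cst_pair n (X : diffSpace R) (x0 : X) : pair_map n x0 :=
  @PairMap R n X x0 (SmoothMap (@cst_smooth (cube R n) X x0))
    (fun _ _ => erefl).

End Preliminaries.

Lemma ideal_quot_eq (V : zmodType) (I : zmodClosed V) (u v : V) :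
  \pi_{ideal_quot I} u = \pi_{ideal_quot I} v <-> u - v \in I.
Proof. by rewrite Quotient.idealrBE; split=> [->|/eqP]. Qed.

Lemma quotient_proj_eq (R : realType) (X : diffSpace R) (e : equiv_rel X)
    (u v : X) : quotient_proj e u = quotient_proj e v <-> e u v.
Proof. by split=> [/eqmodP|H]; last exact/eqmodP. Qed.

(** * The irrational torus as the quotient of the line by Z + theta Z *)

Section IrrationalTorus.
Variables (R : realType) (theta : R).
Local Notation T := (irrational_torus theta).

(** The projection of the plane onto the irrational torus. *)
Definition plane_proj : smooth_map (euclidean R 2) T :=
  smooth_comp
    (@quotient_proj R (torus R) (Quotient.equiv_equiv (torus_line theta)))
    (@quotient_proj R (euclidean R 2) (Quotient.equiv_equiv (@int_lattice R))).

(** The class of [(0, r)]. As each leaf of slope [theta] meets the vertical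
    axis, [torus_pt] is onto; it identifies the irrational torus, as a
    diffeological space, with the quotient of the line by
    [slope_group theta]. *)
Definition torus_pt (r : R) : T := plane_proj (plane_pt 0 r).

Lemma plane_proj_eq (u v : 'rV[R]_2) :
  plane_proj u = plane_proj v <->
  slope_group theta ((u - v) 0 1 - theta * (u - v) 0 0).
Proof.
have E : plane_proj u = plane_proj v <->
    exists t, u - v - plane_pt t (theta * t) \in @int_lattice R.
  apply: iff_trans (@quotient_proj_eq R (torus R)
    (Quotient.equiv_equiv (torus_line theta)) _ _) _.
  rewrite /= Quotient.equivE.
  rewrite -raddfB; split=> [/asboolP[t]|[t]].
    by move=> /(ideal_quot_eq (@int_lattice R)); exists t.
  by move=> /(ideal_quot_eq (@int_lattice R)) tE; apply/asboolP; exists t.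
rewrite {}E; move: (u - v) => w; split.
- move=> [t /forallP Z]; have := Z 0; have := Z 1.
  rewrite !mxE /= => /intrP[m mE] /intrP[n nE].
  exists m, (- n); rewrite -mE rmorphN /= -nE; ring.
- move=> [m [n E]]; exists (w 0 0 + n%:~R).
  apply/forallP; case=> -[|[|//]] i /=; rewrite !mxE /=.
    rewrite (_ : _ - _ = (- n)%:~R) ?intr_int// rmorphN /=.
    by rewrite (_ : Ordinal i = 0); [ring|apply/val_inj].
  rewrite (_ : _ - _ = m%:~R) ?intr_int//.
  rewrite (_ : Ordinal i = 1); last by apply/val_inj.
  by rewrite mulrDr opprD addrA E addrK.
Qed.

Lemma torus_pt_eq r s : torus_pt r = torus_pt s <-> slope_group theta (r - s).
Proof. by rewrite /torus_pt plane_proj_eq !mxE /= subrr mulr0 subr0. Qed.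

Lemma plane_projE v : plane_proj v = torus_pt (v 0 1 - theta * v 0 0).
Proof.
rewrite /torus_pt plane_proj_eq !mxE /= (_ : _ - _ = 0).
  exact: slope_group0.
ring.
Qed.

Lemma torus_pt_surj z : exists r, z = torus_pt r.
Proof.
exists (repr (repr z) 0 1 - theta * (repr (repr z) 0 0)).
by rewrite -plane_projE /= !reprK.
Qed.

(** Every plot of the irrational torus lifts locally through [torus_pt]. *)
Lemma torus_plot_lift n (U : set 'rV[R]_n) p : plot (diffeo T) U p ->
  forall x, U x -> exists V q, [/\ V x, V `<=` U, open V, smooth_fct V q &
    forall y, V y -> p y = torus_pt (q y)].
Proof.
move=> [oU pU] x Ux; have [V [q [Vx VU [oV qV] qp]]] := pU x Ux.
have [W [r [Wx WV [oW sr] rq]]] := qV x Vx.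
exists W, (fun y => r y 0 1 - theta * r y 0 0); split=> //.
- exact: subset_trans VU.
- move=> k; have := CkD oW (sr 1 k) (CkM oW (Ck_cst k W (- theta)) (sr 0 k)).
  by apply: Ck_eq => // y _; rewrite mulNr.
- move=> y Wy; rewrite -plane_projE -qp ?inE; last exact: WV.
  by apply: (congr1 (\pi_{eq_quot _})); rewrite -rq// inE.
Qed.

Lemma torus_pt_plot n (U : set 'rV[R]_n) q : open U -> smooth_fct U q ->
  plot (diffeo T) U (torus_pt \o q).
Proof.
move=> oU sq.
have P : plot (diffeo (euclidean R 2)) U (fun x => plane_pt 0 (q x)).
  split=> //; case=> -[|[|//]] i k.
    by apply: Ck_eq (Ck_cst k U 0) => // x _; rewrite mxE.
  by apply: Ck_eq (sq k) => // x _; rewrite mxE.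
exact: (smoothP plane_proj P).
Qed.

(** * Holonomy: the basic loop is not freely null-homotopic *)

(** Here [u] reparametrizes the line and [c] is a smooth path in an auxiliary
    space [Z], along which [F] gives a homotopy of paths in the torus. If these
    paths are all closed, then the homotopy cannot deform a constant loop into
    the loop [torus_pt \o u]: in a lift to the line over the unit square, the
    former has increment 0 and the latter increment 1. *)
Lemma no_null_homotopy (Z : diffSpace R)
    (F : smooth_map (prod_space Z (unit_interval R)) T) (c : R -> Z)
    (u : R -> R) (x0 : T) :
  plot (diffeo Z) setT (fun v : 'rV[R]_1 => c (v 0 0)) ->
  smooth_fct setT (fun v : 'rV[R]_1 => u (v 0 0)) -> u 0 = 0 -> u 1 = 1 ->
  (forall t, F (c 0, t) = F (c 1, t)) ->
  (forall t, 0 <= t <= 1 -> F (c t, I0 R) = x0) ->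
  (forall t, 0 <= t <= 1 -> F (c t, I1 R) = torus_pt (u t)) -> False.
Proof.
move=> pc su u0 u1 Fends Fbot Ftop.
pose G x y := F (c x, step_unit y).
pose g x y := projT1 (cid (torus_pt_surj (G x y))).
have gE x y : G x y = torus_pt (g x y) by rewrite /g; case: cid.
have Gplot : plot (diffeo T) setT (fun v : 'rV[R]_2 => G (v 0 0) (v 0 1)).
  have P : plot (diffeo (prod_space Z (unit_interval R))) setT
      (fun v : 'rV[R]_2 => (c (v 0 0), step_unit (v 0 1))).
    split=> /=; last first.
      split=> [|k]; first exact: openT.
      by apply: Ck_step (Ck_coord _ _ _); exact: openT.
    have S : smooth_param setT (fun v : 'rV[R]_2 => \row_(_ < 1) v 0 0).
      move=> j k; apply: Ck_eq (Ck_coord k setT (0 : 'I_2)) => //.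
        exact: openT.
      by move=> v _; rewrite mxE.
    have := plot_comp pc (@openT _) S (fun _ _ => I).
    by apply: plot_eq => v _ /=; rewrite mxE.
  exact: (smoothP F P).
have slope_group_cst := countable_valued_cst (slope_group_countable theta).
have [phi phiP] : liftable (slope_group theta) g 0 1 0 1.
  apply: (lift_square (slope_group_countable theta) (slope_group0 theta)
    (@slope_groupB _ theta)).
  move=> x y _ _.
  have [V [q [Vxy _ oV sq qE]]] := torus_plot_lift Gplot (x := plane_pt x y) I.
  have /nbhs_ballP[e /= e0 eV] : nbhs (plane_pt x y) V by exact: open_nbhs_nbhs.
  exists e => // a b s d xa ax xb bx ys sy yd dy.
  have inV x' y' : a <= x' <= b -> s <= y' <= d -> V (plane_pt x' y').
    move=> /andP[? ?] /andP[? ?].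
    by apply: eV; apply: ball_plane_pt; rewrite ltr_norml; apply/andP;
      split; lra.
  exists (fun x' y' => q (plane_pt x' y')); split.
  - move=> x' y' xab ysd; apply/torus_pt_eq.
    by rewrite -gE -qE ?plane_pt_0 ?plane_pt_1//; exact: inV.
  - move=> y' ysd; apply: continuous_in_subspaceT => x'.
    rewrite inE /= in_itv /= => xab.
    apply: (@continuous_comp _ _ _ (@plane_pt R ^~ y') q).
      exact: continuous_plane_ptl.
    by apply: (smooth_fct_continuous oV sq); exact: inV.
  - move=> x' xab; apply: continuous_in_subspaceT => y'.
    rewrite inE /= in_itv /= => ysd.
    apply: (@continuous_comp _ _ _ (@plane_pt R x') q).
      exact: continuous_plane_ptr.
    by apply: (smooth_fct_continuous oV sq); exact: inV.
have i0 : 0 <= (0 : R) <= 1 by rewrite lexx ler01.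
have i1 : 0 <= (1 : R) <= 1 by rewrite lexx ler01.
have [phig phix phiy] := phiP.
have lifts x y : 0 <= x <= 1 -> 0 <= y <= 1 -> torus_pt (phi x y) = G x y.
  by move=> x01 y01; rewrite gE; apply/torus_pt_eq; exact: phig.
have hol : phi 1 0 - phi 0 0 = phi 1 1 - phi 0 1.
  apply: (lift_holonomy (slope_group_countable theta) (slope_group0 theta)
    (@slope_groupB _ theta) phiP).
  by move=> y _; apply/torus_pt_eq; rewrite -!gE /G Fends.
have bot : phi 0 0 = phi 1 0.
  have [r rE] := torus_pt_surj x0.
  suff : phi 0 0 - r = phi 1 0 - r by move/addIr.
  apply: (slope_group_cst _ _ (fun x => phi x 0 - r)) => //.
    by apply: within_addrC; exact: phix.
  by move=> x x01; apply/torus_pt_eq; rewrite lifts// -rE /G step_unit0// Fbot.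
have top : phi 0 1 - u 0 = phi 1 1 - u 1.
  apply: (slope_group_cst _ _ (fun x => phi x 1 - u x)) => //.
    apply: within_subr; first exact: phix.
    exact/continuous_subspaceT/smooth_fct1_continuous.
  by move=> x x01; apply/torus_pt_eq; rewrite lifts// /G step_unit1// Ftop.
move: hol top; rewrite bot u0 u1; lra.
Qed.

(** * The D-topology of the irrational torus is indiscrete *)

Hypothesis htheta : irrational theta.

(** The preimage in the line of a D-open set is open and invariant under the
    dense group [slope_group theta]. *)
Lemma torus_indiscrete (A : set (Dtop T)) : open A -> forall x y, A x -> A y.
Proof.
rewrite DtopE => oA x y.
have [r ->] := torus_pt_surj x; have [s ->] := torus_pt_surj y.
move=> Ar.
have sq : smooth_fct setT (fun v : 'rV[R]_1 => v 0 0).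
  by move=> k; exact: Ck_coord.
have := oA _ _ _ (torus_pt_plot (@openT _) sq); rewrite setTI openE /=.
move=> /(_ (\row_(_ < 1) r)) /=; rewrite /interior /= mxE => /(_ Ar).
move=> /nbhs_ballP[e /= e0 He].
have [c Gc ce] := slope_group_dense htheta (r - s) e0.
have : A (torus_pt (s + c)).
  have := He (\row_(_ < 1) (s + c)); rewrite /= mxE; apply.
  split=> // i j; rewrite !mxE /ball /=; by rewrite opprD addrA.
by rewrite (_ : torus_pt (s + c) = torus_pt s)// torus_pt_eq addrC addKr.
Qed.

Lemma DT_plot n (U : set 'rV[R]_n) (p : 'rV[R]_n -> T) : open U ->
  plot (diffeo (Dspace R (Dtop T))) U p.
Proof.
move=> oU; split=> //; rewrite continuous_open_subspace// => x Ux A.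
rewrite nbhsE => -[B [oB Bx] BA].
have -> : A = setT.
  by apply/seteqP; split=> // y _; apply: BA; exact: torus_indiscrete Bx.
exact: (@filterT _ _ (fmap_filter p (nbhs_filter x))).
Qed.

(** A map that turns every parameterization into a plot is constant. Applied to
    the parameterization with value [a] where the coordinate is nonpositive and
    [b] elsewhere, it gives a plot whose local lift is continuous with values
    in two cosets of [slope_group theta], hence constant. *)
Lemma all_plots_cst (h : T -> T) :
  (forall p : 'rV[R]_1 -> T, plot (diffeo T) setT (h \o p)) ->
  forall a b, h a = h b.
Proof.
move=> hp a b.
pose p (v : 'rV[R]_1) : T := if v 0 0 <= 0 then a else b.
have [ra raE] := torus_pt_surj (h a).
have [rb rbE] := torus_pt_surj (h b).
have [V [q [V0 _ oV sq qE]]] := torus_plot_lift (hp p) (x := \row_(_ < 1) 0) I.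
have /nbhs_ballP[e /= e0 eV] : nbhs (\row_(_ < 1) 0) V by exact: open_nbhs_nbhs.
have inV x : - (e / 2) <= x <= e / 2 -> V (\row_(_ < 1) x).
  move=> /andP[? ?]; apply: eV; split=> // i j; rewrite !mxE /ball /= ltr_norml.
  by apply/andP; split; lra.
pose coset r := [set s | slope_group theta (s - r)].
have coset_countable r : countable (coset r).
  exact/countable_shift/slope_group_countable.
pose D := coset ra `|` coset rb.
have cD : countable D.
  by rewrite /D -bigcup2E; apply: bigcup_countable => // -[|[|i]] _ /=.
have := @countable_valued_cst R (- (e / 2)) (e / 2)
  (fun x => q (\row_(_ < 1) x)) D cD.
move=> /(_ _ _ _)/(congr1 torus_pt).
rewrite -!qE; first last.
- by apply: inV; apply/andP; split; lra.
- by apply: inV; apply/andP; split; lra.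
rewrite /= /p !mxE.
have -> : - (e / 2) <= 0 by lra.
have -> : (e / 2 <= 0) = false by apply/negbTE; rewrite -ltNge; lra.
apply; first by lra.
- apply: continuous_in_subspaceT => x; rewrite inE /= in_itv /= => xe.
  apply: (@continuous_comp _ _ _ (fun x => \row_(_ < 1) x) q).
    exact: continuous_row1.
  by apply: (smooth_fct_continuous oV sq); exact: inV.
- move=> x xe; have := qE _ (inV x xe).
  by rewrite /= /p mxE; case: ifP => _;
    rewrite ?raE ?rbE => /esym /torus_pt_eq H; [left|right].
Qed.

(** * The two halves of the statement *)

Lemma cube1_step (t : R) :
  [forall i, 0 <= (\row_(_ < 1) step t : 'rV[R]_1) 0 i <= 1].
Proof. by apply/forallP => i; rewrite mxE step_ge0 step_le1. Qed.

(** A smooth path, defined on the whole line, that runs through the cube of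
    dimension 1 from end to end. *)
Definition cube_step (t : R) : cube R 1 :=
  exist _ (\row_(_ < 1) step t : 'rV[R]_1) (cube1_step t).

Lemma loop_smooth n (U : set 'rV[R]_n) (p : 'rV[R]_n -> cube R 1) :
  plot (diffeo (cube R 1)) U p ->
  plot (diffeo T) U ((fun s : cube R 1 => torus_pt (val s 0 0)) \o p).
Proof. by move=> [oU sp]; apply: (torus_pt_plot oU (sp 0)). Qed.

Lemma torus_pt1 : torus_pt 1 = torus_pt 0.
Proof. by apply/torus_pt_eq; rewrite subr0; exact: (slope_group_int _ 1). Qed.

Lemma loop_boundary (s : cube R 1) : cube_boundary s ->
  SmoothMap loop_smooth s = torus_pt 0.
Proof. by move=> [i]; rewrite ord1 => -[] /= ->; rewrite ?torus_pt1. Qed.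

(** The loop [t |-> torus_pt t], essential by the holonomy lemma. *)
Definition torus_loop : pair_map 1 (torus_pt 0) := PairMap loop_boundary.

(** All parameterizations are plots of [D T] of the irrational torus, so jumping
    from [f] to [h] through [x0] is a smooth homotopy. *)
Lemma DT_pair_homotopic n (x0 : T) (f h : pair_map n (DT_unit T x0)) :
  pair_homotopic f h.
Proof.
pose F (z : prod_space (cube R n) (unit_interval R)) : Dspace R (Dtop T) :=
  if val z.2 == 0 then f z.1 else if val z.2 == 1 then h z.1 else x0.
have sF m (U : set 'rV[R]_m) p :
    plot (diffeo (prod_space (cube R n) (unit_interval R))) U p ->
    plot (diffeo (Dspace R (Dtop T))) U (F \o p).
  by move=> /plot_open oU; exact: DT_plot.
exists (SmoothMap sF); split=> [s|s|s t bs] /=; rewrite /F /= ?eqxx//.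
- by rewrite oner_eq0.
- by rewrite !pair_boundary//; case: ifP => // _; case: ifP.
Qed.

Lemma not_weak_equivalence : ~ weak_equivalence (DT_unit T).
Proof.
move=> /(_ (torus_pt 0) 1) /bij_inj inj.
have : cst_pair 1 (torus_pt 0) = torus_loop
    %[mod {eq_quot (@pair_homotopicb R 1 T (torus_pt 0))}].
  apply: inj; rewrite !homotopy_set_mapE.
  by apply/eqmodP/asboolP; exact: DT_pair_homotopic.
move=> /eqmodP /asboolP [F [F0 F1 Fb]].
have bd t : t = 0 \/ t = 1 -> cube_boundary (cube_step t).
  by case=> ->; exists 0; rewrite /= mxE;
    [left; rewrite step0|right; rewrite step1].
have sstep n (U : set 'rV[R]_n) i : open U ->
    smooth_fct U (fun v => step (v 0 i)).
  by move=> oU k; apply: Ck_step (Ck_coord _ _ _).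
apply: (@no_null_homotopy _ F cube_step (@step R) (torus_pt 0)).
- split; first exact: openT.
  move=> j k; apply: Ck_eq (sstep _ _ 0 (@openT _) k); first exact: openT.
  by move=> v _ /=; rewrite mxE.
- by apply: sstep; exact: openT.
- by rewrite step0.
- by rewrite step1.
- by move=> t; rewrite !Fb//; apply: bd; [right|left].
- by move=> t _; rewrite F0.
- by move=> t _; rewrite F1 /= mxE.
Qed.

Lemma not_homotopy_equivalent (Y : topologicalType) :
  ~ homotopy_equivalent T (Dspace R Y).
Proof.
move=> [f [g [[F [F0 F1]] _]]].
have cf : continuous (f : Dtop T -> Y).
  by apply/Dtop_adjunction => n U p; exact: (smoothP f).
(* f is continuous for the indiscrete D-topology, so g \o f sends every
   parameterization to a plot. *)
have gf_cst : forall a b, g (f a) = g (f b).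
  apply: (@all_plots_cst (fun x => g (f x))) => p.
  apply: (smoothP g (p := f \o p)).
  have [oU] := DT_plot p (@openT _).
  rewrite continuous_open_subspace// => cp.
  split; rewrite ?continuous_open_subspace// => x Ux.
  by apply: (@continuous_comp _ (Dtop T)); [exact: cp|exact: cf].
have sid n (U : set 'rV[R]_n) i : smooth_fct U (fun v => v 0 i).
  by move=> k; exact: Ck_coord.
apply: (@no_null_homotopy _ F torus_pt id (g (f (torus_pt 0)))) => //.
- by apply: (torus_pt_plot (@openT _)).
- by move=> t; rewrite torus_pt1.
- by move=> t _; rewrite F0; exact: gf_cst.
Qed.

End IrrationalTorus.

Theorem proposition7p2 (R : realType) (theta : R) (htheta : irrational theta) :
  ~ weak_equivalence (DT_unit (irrational_torus theta)) /\
  ~ (exists Y : topologicalType,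
       homotopy_equivalent (irrational_torus theta) (Dspace R Y)).
Proof.
split; first exact: not_weak_equivalence.
by move=> [Y]; exact: not_homotopy_equivalent.
Qed.
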